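(* Fix a recommendation $\boldsymbol{x}\in\mathcal{X}$ and $\eta\in(0,1)$. Suppose each $h_j$, $j\in\mathcal{J}$, is Lipschitz continuous with respect to the $\ell_2$ norm in its first argument, that is, there exists a positive constant $C$ such that for all $\boldsymbol{q}_1,\boldsymbol{q}_2$ and $\boldsymbol{z}$, $|h_j(\boldsymbol{q}_1,\boldsymbol{z})-h_j(\boldsymbol{q}_2,\boldsymbol{z})|\le C\cdot\|\boldsymbol{q}_1-\boldsymbol{q}_2\|_2$. Define the constraint set of the $\Gamma$-concentration as $$\mathcal{H}_\Gamma(\boldsymbol{Q}(\boldsymbol{x}))=\left\{\boldsymbol{z}:\ \mathbb{E}[h_j(\boldsymbol{Q}(\boldsymbol{x}),\boldsymbol{z})]\le0\ \ \forall j\in\mathcal{J},\ \ \mathrm{Var}[\boldsymbol{Q}(\boldsymbol{x})]\le\boldsymbol{\Gamma}^2\right\}$$ and the set of a weaker chance constraint as $$\mathcal{H}_C(\boldsymbol{Q}(\boldsymbol{x}))=\left\{\boldsymbol{z}:\ \mathbb{E}[h_j(\boldsymbol{Q}(\boldsymbol{x}),\boldsymbol{z})]\le0,\ \ \mathbb{P}\left[h_j(\boldsymbol{Q}(\boldsymbol{x}),\boldsymbol{z})\le\frac{C\cdot\|\boldsymbol{\Gamma}\|_2}{\sqrt{1-\eta}}\right]\ge\eta,\ \ \forall j\in\mathcal{J}\right\}.$$ Then $\mathcal{H}_\Gamma(\boldsymbol{Q}(\boldsymbol{x}))\subseteq\mathcal{H}_C(\boldsymbol{Q}(\boldsymbo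l{x}))$.
   Context: $\boldsymbol{Q}(\boldsymbol{x})=(Q_t^{u,v,r}(\boldsymbol{x}))_{t\in\mathcal{T},(u,v,r)\in\mathcal{F}}$ is the random vector of path flows, which takes finitely many values: $\mathcal{T}$ is a finite set of time indices; $\mathcal{F}$ is the finite set of triplets $(u,v,r)$ with $(u,v)$ an origin-destination pair and $r$ in its finite path set $\mathcal{R}^{u,v}$; $\mathcal{P}$ is a finite set of passengers with path sets $\mathcal{R}_p$, and $\mathcal{P}_t^{u,v}\subseteq\mathcal{P}$ those with pair $(u,v)$ and departure time $t$ (for which $\mathcal{R}_p=\mathcal{R}^{u,v}$); $\mathcal{X}=\{\boldsymbol{x}:\ x_{p,r}\in\{0,1\},\ \sum_{r\in\mathcal{R}_p}x_{p,r}=1\ \forall p\in\mathcal{P}\}$; and $Q_t^{u,v,r}(\boldsymbol{x})=\sum_{p\in\mathcal{P}_t^{u,v}}\sum_{r'\in\mathcal{R}^{u,v}}x_{p,r'}\mathbb{1}_{p,r'}^r$, where $\mathbb{1}_{p,r'}^r$ is the Bernoulli indicator that $p$ chooses $r$ when recommended $r'$. The $h_j$ ($j\in\mathcal{J}$, a set of constraint indices) are the real-valued constraint functions, with arguments a path flow vector $\boldsymbol{q}$ and a decision vector $\boldsymbol{z}$, of an inner minimization problem in the general format $\min_{\boldsymbol{z}}\{g(\boldsymbol{Q}(\boldsymbol{x}),\boldsymbol{z}):\ h_j(\boldsymbol{Q}(\boldsymbol{x}),\boldsymbol{z})\le0\ \forall j\in\mathcal{J}\}$ (in the application, they encode the network-loading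 constraints of a transit network with onboard flows $\boldsymbol{z}$). $\boldsymbol{\Gamma}=(\Gamma_t^{u,v,r})_{(u,v,r)\in\mathcal{F},t\in\mathcal{T}}$ is a vector of positive constants; $\mathrm{Var}[\boldsymbol{Q}(\boldsymbol{x})]\le\boldsymbol{\Gamma}^2$ means $\mathrm{Var}[Q_t^{u,v,r}(\boldsymbol{x})]\le(\Gamma_t^{u,v,r})^2$ for every component (this condition does not involve $\boldsymbol{z}$; if it fails, $\mathcal{H}_\Gamma$ is empty). $\eta$ is the predefined probability-guarantee parameter. Expectations and probabilities are over $\boldsymbol{Q}(\boldsymbol{x})$. *)

(* Defs.v *)
From HB Require Import structures.
From mathcomp Require Export all_boot all_order all_algebra.
From mathcomp Require Export all_classical all_reals all_analysis.
Set Implicit Arguments.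
Unset Strict Implicit.
Unset Printing Implicit Defensive.
Import Order.TTheory GRing.Theory Num.Theory.

Local Open Scope classical_set_scope.
Local Open Scope ring_scope.

(* [OD] is the set of origin-destination pairs and [routes w] is the path set
   of the pair [w]. *)
Section PathFlow.
Context (node route time : finType).
Variables (OD : {set node * node}) (routes : node * node -> {set route}).

Definition od_path (f : node * node * route) : bool :=
  (f.1 \in OD) && (f.2 \in routes f.1).

(* The components (t, (u, v, r)) of a path flow vector. *)
Definition flow_index : finType := (time * {f | od_path f})%type.

Context (passenger : finType).
Variables (od : passenger -> node * node) (departure : passenger -> time).

Definition passenger_routes (p : passenger) : {set route} := routes (od p).

Definition passengers (t : time) (w : node * node) : {set passenger} :=
  finset (fun p => (od p == w) && (departure p == t)).

(* Only the entries [x p r] with [r] in the path set of [p] are meaningful;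
   the others are neither constrained here nor used in [path_flow]. *)
Definition recommendations (R : realType) : set (passenger -> route -> R) :=
  [set x | (forall p r, r \in passenger_routes p -> x p r = 0 \/ x p r = 1) /\
           (forall p, \sum_(r in passenger_routes p) x p r = 1)].

(* [chooses p r' r] is the event that passenger [p] chooses path [r] when
   recommended path [r']. *)
Definition path_flow (R : realType) (Omega : Type)
    (chooses : passenger -> route -> route -> set Omega)
    (x : passenger -> route -> R) (omega : Omega) : {ffun flow_index -> R} :=
  [ffun i : flow_index =>
    let: (w, r) := val i.2 in
    \sum_(p in passengers i.1 w) \sum_(r' in routes w)
      x p r' * \1_(chooses p r' r) omega].

End PathFlow.

Definition l2norm (R : realType) (I : finType) (q : {ffun I -> R}) : R :=
  Num.sqrt (\sum_i q i ^+ 2).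

(* The norm the library puts on row vectors and matrices is the sup
   norm, hence this definition in place of [lipschitz]. *)
Definition l2_lipschitz_fst (R : realType) (I : finType) (Z : Type) (C : R)
    (h : {ffun I -> R} -> Z -> R) : Prop :=
  forall q1 q2 z, `|h q1 z - h q2 z| <= C * l2norm (q1 - q2).

Section ConstraintSets.
Context d (Omega : measurableType d) (R : realType) (P : probability Omega R).
Context (I : finType) (J Z : Type).
Variables (Q : Omega -> {ffun I -> R}) (h : J -> {ffun I -> R} -> Z -> R).

Definition concentration_set (Gamma : {ffun I -> R}) : set Z :=
  [set z | (forall j, ('E_P[fun omega => h j (Q omega) z] <= 0)%E) /\
           (forall i, ('V_P[fun omega => Q omega i] <= (Gamma i ^+ 2)%:E)%E)].

Definition chance_set (C eta : R) (Gamma : {ffun I -> R}) : set Z :=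
  [set z | forall j, ('E_P[fun omega => h j (Q omega) z] <= 0)%E /\
     (eta%:E <= P [set omega |
        (h j (Q omega) z <= C * l2norm Gamma / Num.sqrt (1 - eta))%R])%E].

End ConstraintSets.

(* Main.v *)
Require Import Defs.
From mathcomp Require Import all_boot all_order all_algebra.
From mathcomp Require Import all_classical all_reals all_analysis.
From mathcomp Require Import measurable_realfun.
Set Implicit Arguments.
Unset Strict Implicit.
Unset Printing Implicit Defensive.
Import Order.TTheory GRing.Theory Num.Theory.
Local Open Scope classical_set_scope.
Local Open Scope ring_scope.

(** The variance of a Lipschitz function [g] of a random vector [Q] is
    controlled by the variances of the components: it is at most the mean
    squared distance of [g Q] to the fixed number [g (E Q)], which by the
    Lipschitz property is at most [C ^ 2] times the mean of the squared l2
    distance between [Q] and [E Q], that is, [C ^ 2] times the sum of the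
    component variances ([variance_lipschitz_le]). Applied to the path flows and
    to [h j], under the bounds [Gamma i ^ 2] on the component variances, it
    yields a variance at most the square of [s = C * l2norm Gamma].

    As the mean is nonpositive, exceeding [a = s / sqrt (1 - eta)] means a
    deviation of more than [a] from the mean, which by Chebyshev's inequality has
    probability at most [s ^ 2 / a ^ 2 = 1 - eta] ([chebyshev_upper_tail]).

    Measurability and square integrability of the functions [h j] of the path
    flows come from the path flows taking finitely many values
    ([path_flow_finite_range]), so that any function of them is a simple random
    variable ([finite_valued_comp_Lfun2]). *)

(** * Square integrability and variance *)

Lemma bounded_Lfun2 (d : measure_display) (T : measurableType d) (R : realType)
    (P : probability T R) (f : T -> R) (M : R) :
  measurable_fun setT f -> (forall w, `|f w| <= M) -> f \in Lfun P 2%:E.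
Proof.
move=> mf fM; rewrite inE/=; apply/andP; split; rewrite inE//=.
rewrite /finite_norm unlock poweR_lty//.
apply: (@le_lt_trans _ _ (\int[P]_x (M `^ 2)%:E)%E).
  apply: (@le_trans _ _ (\int[P]_x (`|f x| `^ 2)%:E)%E) => //.
  apply: ge0_le_integral => //.
  - apply/measurable_EFinP; apply: (measurableT_comp (measurable_powR _)).
    exact: measurableT_comp.
  - move=> w _; rewrite lee_fin ge0_ler_powR ?nnegrE//.
    exact: le_trans (fM w).
by rewrite integral_cst//= probability_setT mule1 ltry.
Qed.

Lemma finite_range_Lfun2 (d : measure_display) (T : measurableType d)
    (R : realType) (P : probability T R) (f : T -> R) :
  measurable_fun setT f -> finite_set (range f) -> f \in Lfun P 2%:E.
Proof.
move=> mf /finite_seqP[s fs].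
apply: (@bounded_Lfun2 _ _ _ _ _ (\sum_(y <- s) `|y|)) => // w.
have ws : f w \in s by have := imageT f w; rewrite fs.
by rewrite (big_rem _ ws)/= lerDl sumr_ge0.
Qed.

Lemma variance_integral (d : measure_display) (T : measurableType d)
    (R : realType) (P : probability T R) (f : T -> R) :
  ('V_P[f] = \int[P]_w ((f w - fine 'E_P[f]) ^+ 2)%:E)%E.
Proof. by rewrite /variance covariance.unlock unlock. Qed.

(** The mean minimizes the mean squared distance: the mean squared distance
    to [c] exceeds the variance by the square of the distance of [c] to the
    mean. *)
Lemma variance_le_sqr_dist (d : measure_display) (T : measurableType d)
    (R : realType) (P : probability T R) (f : T -> R) (c : R) :
  f \in Lfun P 2%:E -> ('V_P[f] <= \int[P]_w ((f w - c) ^+ 2)%:E)%E.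
Proof.
move=> f2.
have fc2 : (f \- cst c)%R \in Lfun P 2%:E.
  by rewrite rpredB ?lee1n//= => _; rewrite Lfun_cst.
rewrite -(varianceB_cst_r c f2) varianceE// unlock geeDl// oppe_le0.
exact: sqre_ge0.
Qed.

(** * Lipschitz functions of finite-valued random vectors *)

Section FiniteValued.
Context (d : measure_display) (T : measurableType d) (R : realType).
Context (I : finType).
Variables (Q : T -> {ffun I -> R}).
Hypothesis finQ : finite_set (range Q).
Hypothesis mQ : forall i, measurable_fun setT (fun w => Q w i).

(** Even for an arbitrary [g], a preimage under [g \o Q] is a finite union of
    events [Q = q], each a finite intersection over the components. *)
Lemma finite_valued_measurable_comp (g : {ffun I -> R} -> R) :
  measurable_fun setT (g \o Q).
Proof.
move=> _ Y mY; rewrite setTI.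
have -> : (g \o Q) @^-1` Y = \bigcup_(q in range Q `&` g @^-1` Y)
    \bigcap_(i in [set: I]) ((fun w => Q w i) @^-1` [set q i]).
  apply/seteqP; split => [w Yw|w [q [_ Yq] Qwq]] /=.
    by exists (Q w) => //; split => //; exists w.
  suff -> : Q w = q by [].
  by apply/ffunP => i; exact: Qwq.
apply: fin_bigcup_measurable => [|q _]; first exact: finite_setIl.
apply: fin_bigcap_measurable => // i _.
by rewrite -[X in measurable X]setTI; exact: mQ.
Qed.

Lemma finite_valued_comp_Lfun2 (P : probability T R) (g : {ffun I -> R} -> R) :
  g \o Q \in Lfun P 2%:E.
Proof.
apply: finite_range_Lfun2; first exact: finite_valued_measurable_comp.
by rewrite -(image_comp Q g); exact: finite_image.
Qed.

(** Compare [g Q] with [g m], where [m] is the mean vector of [Q]: the squared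
    distance between [Q] and [m] is a sum over the components, without cross
    terms, so its mean is the sum of the variances and covariances do not
    enter. *)
Lemma variance_lipschitz_le (P : probability T R) (g : {ffun I -> R} -> R)
    (C : R) :
  (forall q1 q2, `|g q1 - g q2| <= C * l2norm (q1 - q2)) ->
  ('V_P[g \o Q] <= (C ^+ 2)%:E * \sum_i 'V_P[fun w => Q w i])%E.
Proof.
move=> glip.
pose m : {ffun I -> R} := [ffun i => fine 'E_P[fun w => Q w i]].
have gQ2 := finite_valued_comp_Lfun2 P g.
apply: le_trans (variance_le_sqr_dist (g m) gQ2) _.
have mD i : measurable_fun setT (fun w => ((Q w i - m i) ^+ 2)%:E).
  by apply/measurable_EFinP/measurable_funX/measurable_funB.
have -> : (\sum_i 'V_P[fun w => Q w i] =
           \int[P]_w \sum_i ((Q w i - m i) ^+ 2)%:E)%E.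
  rewrite ge0_integral_sum//; last by move=> i w _; rewrite lee_fin sqr_ge0.
  by apply: eq_bigr => i _; rewrite variance_integral ffunE.
rewrite -ge0_integralZl//; last first.
- by rewrite lee_fin sqr_ge0.
- by move=> w _; apply: sume_ge0 => i _; rewrite lee_fin sqr_ge0.
- exact: emeasurable_sum.
apply: ge0_le_integral => //.
- by move=> w _; rewrite lee_fin sqr_ge0.
- apply/measurable_EFinP/measurable_funX/measurable_funB => //.
  exact: finite_valued_measurable_comp.
- by apply: emeasurable_funM => //; exact: emeasurable_sum.
move=> w _; rewrite sumEFin -EFinM lee_fin /=.
have -> : \sum_i (Q w i - m i) ^+ 2 = l2norm (Q w - m) ^+ 2.
  rewrite sqr_sqrtr; first by apply: eq_bigr => i _; rewrite !ffunE.
  by apply: sumr_ge0 => i _; exact: sqr_ge0.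
rewrite -exprMn -[leLHS]real_normK ?num_real//.
by rewrite ler_sqr ?nnegrE// (le_trans _ (glip _ _)).
Qed.
End FiniteValued.

(** * A one-sided tail bound *)

(** The threshold is the one at which Chebyshev's bound on the deviation from
    the mean equals [1 - eta]; a nonpositive mean turns the upper tail into
    such a deviation. The positivity of [s] makes the threshold positive, as
    Chebyshev's inequality demands. *)
Lemma chebyshev_upper_tail (d : measure_display) (T : measurableType d)
    (R : realType) (P : probability T R) (f : T -> R) (s eta : R) :
  f \in Lfun P 2%:E -> 0 < s -> eta < 1 ->
  ('E_P[f] <= 0)%E -> ('V_P[f] <= (s ^+ 2)%:E)%E ->
  (eta%:E <= P [set w | (f w <= s / Num.sqrt (1 - eta))%R])%E.
Proof.
move=> f2 s0 eta1 Ef Vf.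
have mf : f \in mfun by exact: sub_Lfun_mfun f2.
set a := s / _.
have eta10 : 0 < 1 - eta by rewrite subr_gt0.
have a0 : 0 < a by rewrite divr_gt0 ?sqrtr_gt0.
have mle : measurable [set w | f w <= a].
  rewrite -[X in measurable X]setTI.
  by apply: measurable_fun_le => //; move: mf; rewrite inE.
have mt : measurable [set w | a <= `|f w - fine 'E_P[f]%E|].
  rewrite -[X in measurable X]setTI.
  apply: measurable_fun_le => //; apply: measurableT_comp => //.
  by apply: measurable_funB => //; move: mf; rewrite inE.
rewrite -[X in (_ <= P X)%E]setCK probability_setC; last exact: measurableC.
have tail : (P (~` [set w | (f w <= a)%R]) <= (1 - eta)%:E)%E.
  apply: (@le_trans _ _ (P [set w | a <= `|f w - fine 'E_P[f]%E|])).
    apply: le_measure; rewrite ?inE//; first exact: measurableC.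
    move=> w /= /negP; rewrite -ltNge => aw.
    rewrite (le_trans (ltW aw))// (le_trans _ (ler_norm _))// lerDl oppr_ge0.
    exact: fine_le0.
  apply: le_trans (chebyshev (mfun_Sub mf) a0) _.
  apply: (@le_trans _ _ ((a ^- 2)%:E * (s ^+ 2)%:E)%E).
    by apply: lee_wpmul2l => //; rewrite lee_fin invr_ge0 sqr_ge0.
  rewrite -EFinM lee_fin expr_div_n sqr_sqrtr ?(ltW eta10)// invf_div.
  by rewrite divfK// expf_neq0// gt_eqF.
rewrite leeBrDl ?fin_num_measure//; last exact: measurableC.
by apply: le_trans (leeD2r _ tail) _; rewrite -EFinD lee_fin subrK.
Qed.

(** * Path flows as random vectors *)

Lemma measurable_sum_pred (d : measure_display) (T : measurableType d)
    (R : realType) (I : finType) (A : pred I) (f : I -> T -> R) :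
  (forall i, A i -> measurable_fun setT (f i)) ->
  measurable_fun setT (fun w => \sum_(i | A i) f i w).
Proof.
move=> mf; under eq_fun do rewrite big_mkcond /=.
apply: measurable_sum => i; case: (boolP (A i)) => [/mf //|_].
exact: measurable_cst.
Qed.

Section PathFlowRandomVector.
Context (R : realType) (d : measure_display) (Omega : measurableType d).
Context (node route time passenger : finType).
Variables (OD : {set node * node}) (routes : node * node -> {set route}).
Variables (od : passenger -> node * node) (departure : passenger -> time).
Variables (chooses : passenger -> route -> route -> set Omega).
Variables (x : passenger -> route -> R).
Let Q := path_flow OD routes od departure chooses x.

(** The flow is determined by the outcomes of the finitely many choice
    indicators. *)
Lemma path_flow_finite_range : finite_set (range Q).
Proof.
pose choice := {ffun passenger * route * route -> bool}.
pose flow (c : choice) : {ffun flow_index time OD routes -> R} :=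
  [ffun i => let: (w, r) := val i.2 in
    \sum_(p in passengers od departure i.1 w) \sum_(r' in routes w)
      x p r' * (c (p, r', r))%:R].
apply: (@sub_finite_set _ _ (range flow)); last exact/finite_image/finite_finset.
move=> _ [omega _ <-].
exists [ffun pr => omega \in chooses pr.1.1 pr.1.2 pr.2] => //.
apply/ffunP => i; rewrite !ffunE; case: (val i.2) => w r.
by apply: eq_bigr => p _; apply: eq_bigr => r' _; rewrite ffunE indicE.
Qed.

(** Measurability of the choice events is available only for paths of the
    passenger, but a component indexed by a path [r] of the pair [w] sums only
    over passengers of [w] and recommendations among the paths of [w]. *)
Lemma path_flow_measurable i :
  (forall p r' r, r' \in passenger_routes routes od p ->
     r \in passenger_routes routes od p -> measurable (chooses p r' r)) ->
  measurable_fun setT (fun omega => Q omega i).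
Proof.
move=> mchooses; rewrite /Q /path_flow.
under eq_fun do rewrite ffunE.
case: i => t [[w r] /= /andP[/= _ rw]].
apply: measurable_sum_pred => p; rewrite inE => /andP[/eqP odp _].
apply: measurable_sum_pred => r' r'w; apply: measurable_funM => //.
by apply: measurable_indic; apply: mchooses; rewrite /passenger_routes odp.
Qed.
End PathFlowRandomVector.

(** * Concentration implies the chance constraint *)

Theorem proposition4
  (R : realType) (d : measure_display) (Omega : measurableType d)
  (P : probability Omega R)
  (node route time passenger : finType)
  (OD : {set node * node}) (routes : node * node -> {set route})
  (od : passenger -> node * node) (departure : passenger -> time)
  (od_OD : forall p, od p \in OD)
  (chooses : passenger -> route -> route -> set Omega)
  (measurable_chooses : forall p r' r,
     r' \in passenger_routes routes od p -> r \in passenger_routes routes od p ->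
     measurable (chooses p r' r))
  (x : passenger -> route -> R)
  (x_rec : recommendations routes od x)
  (eta : R) (eta_gt0 : 0 < eta) (eta_lt1 : eta < 1)
  (J : Type) (m : nat)
  (h : J -> {ffun flow_index time OD routes -> R} -> 'rV[R]_m -> R)
  (C : R) (C_gt0 : 0 < C)
  (h_lipschitz : forall j, l2_lipschitz_fst C (h j))
  (Gamma : {ffun flow_index time OD routes -> R})
  (Gamma_gt0 : forall i, 0 < Gamma i) :
  let Q : Omega -> {ffun flow_index time OD routes -> R} :=
    path_flow OD routes od departure chooses x in
  concentration_set P Q h Gamma `<=` chance_set P Q h C eta Gamma.
Proof.
move=> Q z [Eh VQ] j; split=> //.
have finQ : finite_set (range Q) by exact: path_flow_finite_range.
have mQ i : measurable_fun setT (fun omega => Q omega i).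
  exact: path_flow_measurable.
pose hz q := h j q z.
(* Without components the threshold is zero, out of reach of Chebyshev's
   inequality, but then the flow vector is deterministic. *)
have [i0 _|noI] := pickP (@predT (flow_index time OD routes)).
  have Gamma2 : 0 < \sum_i Gamma i ^+ 2.
    rewrite (bigD1 i0)//= ltr_pwDl ?exprn_gt0//.
    by apply: sumr_ge0 => i _; exact: sqr_ge0.
  apply: (@chebyshev_upper_tail _ _ _ P (hz \o Q)) => //.
  - exact: finite_valued_comp_Lfun2.
  - by rewrite mulr_gt0// sqrtr_gt0.
  - exact: Eh.
  have hz_lip q1 q2 : `|hz q1 - hz q2| <= C * l2norm (q1 - q2).
    exact: h_lipschitz.
  apply: le_trans (variance_lipschitz_le finQ mQ P hz_lip) _.
  rewrite exprMn sqr_sqrtr ?(ltW Gamma2)// [leRHS]EFinM.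
  apply: lee_wpmul2l; first by rewrite lee_fin sqr_ge0.
  by rewrite -sumEFin; apply: lee_sum => i _; exact: VQ.
have hQ omega : h j (Q omega) z = hz [ffun=> 0].
  by congr (h j _ z); apply/ffunP => i; have := noI i.
have := Eh j.
rewrite (_ : (fun _ => _) = cst (hz [ffun=> 0])); last exact/funext.
rewrite expectation_cst lee_fin => hz0.
rewrite (_ : [set _ | _] = setT).
  by rewrite probability_setT lee_fin ltW.
apply/seteqP; split=> // omega _ /=; rewrite hQ (le_trans hz0)//.
by rewrite divr_ge0 ?sqrtr_ge0// mulr_ge0 ?sqrtr_ge0// ltW.
Qed.
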